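(* There is an $(\omega_1,\omega_2)$-LLSP space, i.e. a locally Lindelöf, scattered, Hausdorff P-space $X$ with $\mathrm{ht}(X)=\omega_2$ and $\mathrm{wd}(X)=\omega_1$.
   Context: A P-space is a space in which every countable intersection of open sets is open. For a space $X$ and ordinal $\alpha$, $X^{\alpha}$ denotes the $\alpha$-th Cantor–Bendixson derivative; $X$ is scattered if $X^{\alpha}=\emptyset$ for some $\alpha$. For scattered $X$, $\mathrm{ht}(X)$ is the least ordinal $\alpha$ with $X^{\alpha}=\emptyset$, $I_\alpha(X)=X^{\alpha}\setminus X^{\alpha+1}$, and $\mathrm{wd}(X)=\sup\{|I_\alpha(X)|:\alpha<\mathrm{ht}(X)\}$. An LLSP space is a locally Lindelöf, scattered, Hausdorff P-space; for an uncountable cardinal $\kappa$ and nonzero ordinal $\alpha$, a $(\kappa,\alpha)$-LLSP space is an LLSP space $X$ with $\mathrm{ht}(X)=\alpha$ and $\mathrm{wd}(X)=\kappa$. *)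

(* Defs.v *)
From mathcomp Require Import all_boot.
From mathcomp Require Import boolp classical_sets functions cardinality topology.
From mathcomp Require wochoice.

Set Implicit Arguments.
Unset Strict Implicit.
Unset Printing Implicit Defensive.

Local Open Scope classical_set_scope.
Local Open Scope card_scope.

(* Ordinals are represented by well-ordered types, [oeq] being equality of the
   ordinals represented. Well-orders in the sense of [wochoice] are reflexive
   and total. *)
Record Ord := MkOrd {
  ord_car :> Type;
  ord_le : rel ord_car;
  ord_wo : wochoice.well_order ord_le }.

Definition ord_lt (a : Ord) (x y : a) : bool := ~~ ord_le y x.

Definition oeq (a b : Ord) : Prop :=
  exists2 f : a -> b, bijective f & {mono f : x y / ord_le x y}.

(* [a] is isomorphic to the initial segment [{z : b | z < t}] of [b] *)
Definition olt (a b : Ord) : Prop :=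
  exists (t : b) (f : a -> b),
    {mono f : x y / ord_le x y} /\ forall z, ord_lt z t <-> exists x, f x = z.

Lemma ord_min (a : Ord) (P : a -> Prop) (x : a) : P x ->
  exists2 m, P m & forall y, P y -> ord_le m y.
Proof.
move=> Px.
have ne : wochoice.nonempty (fun z => `[< P z >] : bool).
  by exists x; rewrite unfold_in; apply/asboolP.
have [m [[Pm lbm] _]] := ord_wo ne.
exists m; first by move: Pm; rewrite unfold_in => /asboolP.
by move=> y Py; apply: lbm; rewrite unfold_in; apply/asboolP.
Qed.

Lemma ord_total (a : Ord) : total (@ord_le a).
Proof.
move=> x y; have [|m] := @ord_min a (fun z => z = x \/ z = y) x; first by left.
case=> -> le; first by rewrite le//; right.
by apply/orP; right; apply: le; left.
Qed.

Lemma ord_le_refl (a : Ord) : reflexive (@ord_le a).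
Proof. by move=> x; have := ord_total x x; rewrite orbb. Qed.

Lemma ord_le_anti (a : Ord) : antisymmetric (@ord_le a).
Proof.
move=> x y /andP[xy yx].
have ne : wochoice.nonempty (fun z => `[< z = x \/ z = y >] : bool).
  by exists x; rewrite unfold_in; apply/asboolP; left.
have [m [_ mu]] := ord_wo ne.
have <- : m = x.
  apply: mu; split=> [|z]; rewrite unfold_in; first by apply/asboolP; left.
  by move=> /asboolP[->|->//]; rewrite ord_le_refl.
apply: mu; split=> [|z]; rewrite unfold_in; first by apply/asboolP; right.
by move=> /asboolP[->//|->]; rewrite ord_le_refl.
Qed.

Lemma ord_le_trans (a : Ord) : transitive (@ord_le a).
Proof.
move=> y x z xy yz.
have [|m] := @ord_min a (fun u => [\/ u = x, u = y | u = z]) x; first exact: Or31.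
case=> -> le; first by apply: le; apply: Or33.
- have yx : ord_le y x by apply: le; apply: Or31.
  by have -> : x = y by apply: ord_le_anti; rewrite xy yx.
- have zy : ord_le z y by apply: le; apply: Or32.
  by have -> : z = y by apply: ord_le_anti; rewrite zy yz.
Qed.

Lemma ord_lt_trans (a : Ord) : transitive (@ord_lt a).
Proof.
move=> y x z xy yz; apply/negP => zx; move/negP: xy; apply.
apply: ord_le_trans zx.
by have := ord_total y z; rewrite (negbTE yz) orbF.
Qed.

Lemma ord_lt_wf (a : Ord) : well_founded (@ord_lt a).
Proof.
move=> x; apply: contrapT => nx.
have [m nm lbm] := @ord_min a (fun z => ~ Acc (@ord_lt a) z) x nx.
apply: nm; constructor => y ym; apply: contrapT => ny.
by move: ym; rewrite /ord_lt lbm.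
Qed.

Lemma olt_wf : well_founded olt.
Proof.
move=> b; constructor => c [t [f [fle fim]]].
elim/(well_founded_ind (@ord_lt_wf b)): t c f fle fim => t IH c f fle fim.
have flt w : ord_lt (f w) t by apply/fim; exists w.
constructor => d [s [g [gle gim]]].
apply: (IH (f s) _ d (f \o g)) => //=.
  by move=> x y; rewrite /= fle gle.
move=> z; split => [zs|[x <-]]; last first.
  by rewrite /ord_lt fle; apply/gim; exists x.
have [w wz] := (fim z).1 (ord_lt_trans zs (flt s)).
have [|x xw] := (gim w).1; first by rewrite /ord_lt -fle wz.
by exists x; rewrite /= xw.
Qed.

Definition osucc_le (a : Ord) (x y : option a) : bool :=
  match x, y with
  | _, None => true
  | None, Some _ => false
  | Some u, Some v => ord_le u v
  end.

Lemma osucc_wo (a : Ord) : wochoice.well_order (@osucc_le a).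
Proof.
apply: wochoice.antisymmetric_well_order.
  by move=> [x|] [y|] //= /ord_le_anti ->.
move=> A [x Ax].
have [[y Ay]|noS] := pselect (exists y : a, Some y \in A).
  have [m Am lbm] := @ord_min a (fun z => Some z \in A) y Ay.
  by exists (Some m); split=> // -[z|] //= /lbm.
exists None; split=> [|[z|] Az//]; last by case: noS; exists z.
by case: x Ax => // y Ay; case: noS; exists y.
Qed.

(* the ordinal a + 1, with [None] as its greatest element *)
Definition osucc (a : Ord) : Ord := MkOrd (@osucc_wo a).

Definition olimit (a : Ord) : Prop :=
  inhabited a /\ ~ exists b, oeq a (osucc b).

(* [h] is the least ordinal that does not inject into [T] *)
Definition is_hartogs (T : Type) (h : Ord) : Prop :=
  ~ ([set: h] #<= [set: T]) /\
  forall b, olt b h -> [set: b] #<= [set: T].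

Lemma cantor_inj (T : Type) : ~ ([set: T -> bool] #<= [set: T]).
Proof.
move=> /card_leP[f].
have [g gI] : exists g : (T -> bool) -> T, injective g.
  exists (fun A => val (f (SigSub (in_setT A)))) => A B /val_inj e.
  by have [] := 'inj_f (in_setT _) (in_setT _) e.
pose D x := `[< exists2 A : T -> bool, g A = x & ~~ A x >].
have [DgD|nDgD] := boolP (D (g D)).
  by have /asboolP[A /gI -> ] := DgD; rewrite DgD.
by have /asboolP := nDgD; apply; exists D.
Qed.

Lemma hartogs_ex (T : Type) : exists h, is_hartogs T h.
Proof.
have [R Rwo] := wochoice.well_ordering_principle {classic (T -> bool)}.
pose o := MkOrd Rwo.
have : ~ ([set: o] #<= [set: T]) by exact: cantor_inj.
elim/(well_founded_ind olt_wf): o => {R Rwo} o IH nT.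
have [[b [bo nb]]|nob] := pselect (exists b, olt b o /\ ~ ([set: b] #<= [set: T])).
  exact: IH nb.
by exists o; split=> // b bo; apply: contrapT => nb; apply: nob; exists b.
Qed.

Definition hartogs (T : Type) : Ord := projT1 (cid (hartogs_ex T)).

Lemma hartogsP (T : Type) : is_hartogs T (hartogs T).
Proof. exact: (projT2 (cid (hartogs_ex T))). Qed.

Definition omega1 : Ord := hartogs nat.

Definition omega2 : Ord := hartogs omega1.

Section LLSP.
Variable X : topologicalType.

Definition derived (A : set X) : set X := A `&` limit_point A.

Definition CB_step (a : Ord) (D : forall b, olt b a -> set X) : set X :=
  [set x |
    (forall b (ba : olt b a), oeq a (osucc b) -> derived (D b ba) x) /\
    (olimit a -> forall b (ba : olt b a), D b ba x)].

(* X^0 = X, X^(b + 1) = (X^b)' and X^a is the intersection of the X^b, b < a,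
   for limit a *)
Definition CB : Ord -> set X := Fix olt_wf (fun=> set X) CB_step.

Lemma CBE (a : Ord) : CB a = CB_step (fun b (_ : olt b a) => CB b).
Proof.
rewrite /CB Fix_eq// => c D E DE; congr CB_step.
by apply: functional_extensionality_dep => b; apply: funext => bc; exact: DE.
Qed.

Definition scattered : Prop := exists a, CB a = set0.

Definition is_ht (h : Ord) : Prop :=
  CB h = set0 /\ forall b, olt b h -> CB b <> set0.

Definition CB_level (a : Ord) : set X := CB a `\` CB (osucc a).

(* The cardinality of [k] is the supremum of the |I_a(X)|, a < ht(X), in the
   class of cardinals: cardinals are represented by arbitrary ordinals and
   compared by [#<=]. *)
Definition is_wd (k : Ord) : Prop :=
  let ub (c : Ord) :=
    forall h a, is_ht h -> olt a h -> CB_level a #<= [set: c] in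
  ub k /\ forall c, ub c -> [set: k] #<= [set: c].

Definition lindelof (A : set X) : Prop :=
  forall U : set (set X), (forall u, U u -> open u) ->
    A `<=` \bigcup_(u in U) u ->
    exists V : set (set X),
      [/\ V `<=` U, countable V & A `<=` \bigcup_(u in V) u].

Definition locally_lindelof : Prop :=
  forall x : X, exists2 N, nbhs x N & lindelof N.

Definition P_space : Prop :=
  forall U : nat -> set X, (forall n, open (U n)) -> open (\bigcap_n U n).

Definition LLSP : Prop :=
  [/\ locally_lindelof, scattered, hausdorff_space X & P_space].

Definition kappa_alpha_LLSP (k a : Ord) : Prop :=
  [/\ LLSP, is_ht a & is_wd k].

End LLSP.

(* Main.v *)
From HB Require Import structures.
Require Import Defs.
From mathcomp Require Import all_boot.
From mathcomp Require Import boolp classical_sets functions cardinality topology.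
From mathcomp Require wochoice.

(* The points of level t < omega2 are the pairs (t, r) with r < omega1. A basic
   neighbourhood of (t, r) consists of (t, r) and of all but countably many of
   the pieces W t i (i < omega1) of colour r, where every colour occurs
   uncountably often; the pieces are disjoint countable unions of basic
   neighbourhoods of points of lower level, and W t i meets countably many lower
   levels, which exhaust t as i grows. What could go wrong, at t of countable
   cofinality, is that countably many neighbourhoods already cover a lower
   level. To rule this out, every level b is split into omega1 uncountable
   columns {(b, r) | rho r = xi}, and, for the levels b listed before stage i,
   W t i avoids the columns of index below i: hence every basic neighbourhood
   meets every column in a countable set, and W t i can start from points in
   columns of index i. That the derived set of order a consists of the levels
   from a on is then immediate from the comparability of well-orders. *)

Set Implicit Arguments.
Unset Strict Implicit.
Unset Printing Implicit Defensive.

Local Open Scope classical_set_scope.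
Local Open Scope card_scope.

(** * Comparing well-orders *)

Section OrdBasics.
Variable a : Ord.
Implicit Types x y z : a.

Lemma ord_ltW x y : ord_lt x y -> ord_le x y.
Proof. by rewrite /ord_lt; have := ord_total x y; case: (ord_le x y) => //= ->. Qed.

Lemma ord_lt_irr x : ord_lt x x = false.
Proof. by rewrite /ord_lt ord_le_refl. Qed.

Lemma ord_lt_le_trans y x z : ord_lt x y -> ord_le y z -> ord_lt x z.
Proof. by move=> xy yz; apply: contra xy => zx; exact: ord_le_trans yz zx. Qed.

Lemma ord_lt_total x y : [\/ ord_lt x y, x = y | ord_lt y x].
Proof.
rewrite /ord_lt; case: (boolP (ord_le y x)) => [yx|_]; last exact: Or31.
case: (boolP (ord_le x y)) => [xy|_]; last exact: Or33.
by apply: Or32; apply: ord_le_anti; rewrite xy.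
Qed.

Lemma ord_le_lt x y : ord_le x y = ~~ ord_lt y x.
Proof. by rewrite /ord_lt negbK. Qed.

Lemma seg_wo (t : a) :
  @wochoice.well_order {z : a | ord_lt z t} (fun u v => ord_le (sval u) (sval v)).
Proof.
apply: wochoice.antisymmetric_well_order.
  move=> x y /ord_le_anti e; case: x y e => [x xt] [y yt] /= e.
  by subst y; congr exist; exact: bool_irrelevance.
move=> A [[x xt] Ax].
have [|m [mt Am] lbm] := @ord_min a (fun z => exists zt, exist _ z zt \in A) x.
  by exists xt.
by exists (exist _ m mt); split=> // -[z zt] Az; apply: lbm; exists zt.
Qed.

End OrdBasics.

Definition seg (a : Ord) (t : a) : Ord := MkOrd (@seg_wo a t).

Section OrdCompare.
Implicit Types a b c : Ord.

Lemma oeq_refl a : oeq a a.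
Proof. by exists id => //; exists id. Qed.

Lemma oeq_sym a b : oeq a b -> oeq b a.
Proof.
case=> f [g fK gK] fle; exists g; first by exists f.
by move=> x y; rewrite -fle !gK.
Qed.

Lemma oeq_trans b a c : oeq a b -> oeq b c -> oeq a c.
Proof.
case=> f fb fle [g gb gle]; exists (g \o f); first exact: bij_comp.
by move=> x y /=; rewrite gle fle.
Qed.

Lemma olt_irr a : ~ olt a a.
Proof. by elim/(well_founded_ind olt_wf): a => a IH aa; exact: (IH a). Qed.

Lemma mono_ord_inj a b (f : a -> b) : {mono f : x y / ord_le x y} -> injective f.
Proof. by move=> fle x y e; apply: ord_le_anti; rewrite -!fle e ord_le_refl. Qed.

Lemma mono_ord_lt a b (f : a -> b) : {mono f : x y / ord_le x y} ->
  {mono f : x y / ord_lt x y}.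
Proof. by move=> fle x y; rewrite /ord_lt fle. Qed.

Lemma oeq_segI a b (t : b) (f : a -> b) : {mono f : x y / ord_le x y} ->
  (forall z, ord_lt z t <-> exists x, f x = z) -> oeq a (seg t).
Proof.
move=> fle fim.
have ft x : ord_lt (f x) t by apply/fim; exists x.
have [|g gP] := @choice (seg t) a (fun z x => f x = sval z).
  by case=> z zt; apply/fim.
exists (fun x => exist _ (f x) (ft x)); last by move=> x y; exact: fle.
exists g => [x|[z zt]].
  by apply: (mono_ord_inj fle); rewrite gP.
have := gP (exist _ z zt) => /= e.
by move: (ft _); rewrite e => h; congr exist; exact: bool_irrelevance.
Qed.

Lemma olt_seg a (t : a) : olt (seg t) a.
Proof.
exists t, sval; split=> // z; split=> [zt|[[w wt] <-]//].
by exists (exist _ z zt).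
Qed.

Lemma oltE a b : olt a b <-> exists t : b, oeq a (seg t).
Proof.
split=> [[t [f [fle fim]]]|[t [f [g fK gK] fle]]]; first by exists t; exact: oeq_segI fim.
exists t, (fun x => sval (f x)); split=> // z; split=> [zt|[x <-]].
  by exists (g (exist _ z zt)); rewrite gK.
by case: (f x).
Qed.

Lemma oeq_olt b a c : oeq a b -> olt b c -> olt a c.
Proof. by move=> ab /oltE[t bt]; apply/oltE; exists t; exact: oeq_trans bt. Qed.

Lemma olt_segE a b (t : b) : olt a (seg t) <-> exists2 s, ord_lt s t & oeq a (seg s).
Proof.
split=> [[[s st] [f [fle fim]]]|[s st /oeq_olt]].
  exists s => //; apply: (@oeq_segI _ _ _ (sval \o f)) => [x y|z]; first exact: fle.
  split=> [zs|[x <-]]; last by apply/(fim (f x)); exists x.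
  have [x xz] := (fim (exist _ z (ord_lt_trans zs st))).1 zs.
  by exists x; rewrite /= xz.
apply; exists (exist _ s st).
have lt_t (z : seg s) : ord_lt (sval z) t by case: z => z zs; exact: ord_lt_trans st.
exists (fun z => exist _ (sval z) (lt_t z)); split=> // -[z zt].
split=> [zs|[[w ws] /(congr1 sval) /= wz]]; last by rewrite /ord_lt /= -wz.
by exists (exist _ z zs); congr exist; exact: bool_irrelevance.
Qed.

Lemma olt_trans b a c : olt a b -> olt b c -> olt a c.
Proof.
move=> ab /oltE[t [f [g fK gK] fle]].
have /olt_segE[s _ asg] : olt a (seg t); last by apply/oltE; exists s.
have [s [u [ule uim]]] := ab.
exists (f s), (f \o u); split=> [x y|z]; first exact: etrans (fle _ _) (ule _ _).
rewrite -(gK z) (mono_ord_lt fle) uim; split=> -[x e]; exists x; first by rewrite /= e.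
by rewrite -(fK (u x)) -(fK (g z)); congr g.
Qed.

Lemma olt_oeq b a c : olt a b -> oeq b c -> olt a c.
Proof.
move=> [s [u [ule uim]]] [f [g fK gK] fle].
exists (f s), (f \o u); split=> [x y|z]; first by rewrite /= fle ule.
rewrite -(gK z) (mono_ord_lt fle) uim; split=> -[x e]; exists x; first by rewrite /= e.
by rewrite -(fK (u x)) -(fK (g z)); congr g.
Qed.

(** Were [s] and [t] different, one segment would be isomorphic to a proper initial segment of
    itself, against [olt_irr]. *)
Lemma seg_inj a (s t : a) : oeq (seg s) (seg t) -> s = t.
Proof.
move=> e; have [st|//|ts] := ord_lt_total s t.
  case: (@olt_irr (seg s)); apply: olt_oeq (oeq_sym e).
  by apply/olt_segE; exists s => //; exact: oeq_refl.
case: (@olt_irr (seg t)); apply: olt_oeq e.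
by apply/olt_segE; exists t => //; exact: oeq_refl.
Qed.

Lemma seg_olt a (s t : a) : olt (seg s) (seg t) <-> ord_lt s t.
Proof.
split=> [/olt_segE[r rt /seg_inj -> //]|st].
by apply/olt_segE; exists s => //; exact: oeq_refl.
Qed.

Lemma oeq_seg_None a : oeq a (@seg (osucc a) None).
Proof.
apply: (@oeq_segI a (osucc a) None Some) => // -[z|]; last by split=> [|[]].
by split=> // _; exists z.
Qed.

Lemma olt_succ a b : olt a (osucc b) <-> olt a b \/ oeq a b.
Proof.
have bN := oeq_seg_None b.
split=> [/oltE[[t|] at_]|[ab|ab]].
- by left; apply: olt_oeq (oeq_sym bN); apply/olt_segE; exists (Some t).
- by right; exact: oeq_trans (oeq_sym bN).
- by apply: (olt_trans ab); apply/oltE; exists None.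
- by apply/oltE; exists None; exact: oeq_trans bN.
Qed.

Lemma olt_limit a b : ~ (exists c, oeq a (osucc c)) -> olt b a ->
  exists2 c, olt b c & olt c a.
Proof.
move=> nsucc /oltE[u bu].
have [[v uv]|nv] := pselect (exists v, ord_lt u v).
  by exists (seg v); [apply: oeq_olt bu _; apply/seg_olt|exact: olt_seg].
(* With nothing above [u], [u] is the greatest element, so [a] is [seg u] followed by one point. *)
case: nsucc; exists (seg u); apply: oeq_sym.
have nlt z : ~~ ord_lt u z by apply/negP => uz; apply: nv; exists z.
pose f (z : osucc (seg u)) := if z is Some w then sval w else u.
have fle : {mono f : x y / ord_le x y}.
  case=> [[x xu]|] [[y yu]|] //=; last by rewrite ord_le_refl.
    exact: ord_ltW.
  by apply/negbTE.
have fsurj z : exists x, f x = z.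
  have [zu|->|uz] := ord_lt_total z u; last by move: (nlt z); rewrite uz.
    by exists (Some (exist _ z zu)).
  by exists None.
have [g gP] := choice fsurj.
exists f => //; exists g => // x.
by apply: (mono_ord_inj fle); rewrite gP.
Qed.

(** Induction on [a]. Unless some segment of [a] already exceeds all segments of [b], every [seg x]
    matches some [seg (f x)], and [f] embeds [a] onto a downward closed part of [b]: either all of
    [b], or the segment below the least element missed. *)
Lemma olt_comparable a b : olt a b \/ forall t : b, olt (seg t) a.
Proof.
elim/(well_founded_ind olt_wf): a => a IH.
have [[x xP]|nx] := pselect (exists x : a, forall t : b, olt (seg t) (seg x)).
  by right=> t; apply: olt_trans (xP t) (olt_seg x).
have [|f fP] := @choice a b (fun x t => oeq (seg x) (seg t)).
  move=> x.
  have [/oltE//|h] := IH _ (olt_seg x); by case: nx; exists x.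
have flt : {mono f : x y / ord_lt x y}.
  move=> x y; apply/idP/idP => /seg_olt xy; apply/seg_olt.
    by apply: oeq_olt (fP x) (olt_oeq xy (oeq_sym (fP y))).
  by apply: oeq_olt (oeq_sym (fP x)) (olt_oeq xy (fP y)).
have fle : {mono f : x y / ord_le x y} by move=> x y; rewrite !ord_le_lt flt.
have fdown s x : ord_lt s (f x) -> exists y, f y = s.
  move=> /seg_olt sx; have /olt_segE[y _ sy] := olt_oeq sx (oeq_sym (fP x)).
  by exists y; apply: seg_inj; exact: oeq_trans (oeq_sym (fP y)) (oeq_sym sy).
have [[s ns]|all_s] := pselect (exists s, ~ exists x, f x = s); last first.
  right=> t; have [x <-] : exists x, f x = t by apply: contrapT => nt; apply: all_s; exists t.
  exact: oeq_olt (oeq_sym (fP x)) (olt_seg x).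
have [m nm lbm] := @ord_min b (fun s => ~ exists x, f x = s) s ns.
left; apply/oltE; exists m; apply: (oeq_segI fle) => z; split=> [zm|[x <-]].
  by apply: contrapT => nz; move: zm; rewrite /ord_lt lbm.
have [//|e|/fdown//] := ord_lt_total (f x) m.
by case: nm; exists x.
Qed.

End OrdCompare.

(** * Derivatives of a space with a rank function *)

Section CantorBendixson.
Variables (X : topologicalType) (o : Ord) (lev : X -> o).
Hypothesis lev_isolated : forall x : X, exists2 U : set X, nbhs x U &
  forall y, U y -> y <> x -> ord_lt (lev y) (lev x).
Hypothesis lev_limit : forall (x : X) s (U : set X), ord_lt s (lev x) -> nbhs x U ->
  exists2 y, U y & lev y = s.

(** [lev] is the Cantor-Bendixson rank: a point is isolated among the points of level at least its
    own, and is a limit of every lower level. Since [a] is an arbitrary well-order, a level enters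
    as the segment it cuts off. *)
Lemma CB_lev a : @CB X a = [set x | ~ olt (seg (lev x)) a].
Proof.
elim/(well_founded_ind olt_wf): a => a IH; rewrite CBE; apply/seteqP.
split=> x /=.
  case=> succ lim xa.
  have [[b ab]|ns] := pselect (exists b, oeq a (osucc b)).
    have ba : olt b a by apply: olt_oeq (oeq_sym ab); apply/olt_succ; right; exact: oeq_refl.
    have [CBbx lx] := succ b ba ab; rewrite IH // in CBbx.
    have /olt_succ[//|xb] := olt_oeq xa ab.
    have [U Ux Ulev] := lev_isolated x.
    have [y [/eqP yx CBy Uy]] := lx U Ux; rewrite IH // in CBy.
    by apply: CBy; apply: olt_oeq xb; apply/seg_olt; exact: Ulev.
  have [c xc ca] := olt_limit ns xa.
  have ia : inhabited a by case: xa => t _; exists.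
  by have := lim (conj ia ns) c ca; rewrite IH.
move=> nxa; split=> [b ba ab|_ b ba]; rewrite IH //; last first.
  by move=> xb; apply: nxa; exact: olt_trans ba.
have nxs : ~ olt (seg (lev x)) (osucc b) by move=> h; apply: nxa; exact: olt_oeq (oeq_sym ab).
split=> [xb|U Ux]; first by apply: nxs; apply/olt_succ; left.
(* Either [b] is the segment of a level [s], or every segment of [o] is shorter than [b], against
   [nxs]. *)
have [|/(_ (lev x)) xb] := olt_comparable b o; last by case: nxs; apply/olt_succ; left.
move=> /oltE[s bs]; have [sx|e|xs] := ord_lt_total s (lev x).
- have [y Uy ys] := lev_limit sx Ux; exists y; split=> //.
    by apply/eqP => e; move: sx; rewrite -ys e ord_lt_irr.
  by rewrite /= ys => sb; apply: (@olt_irr b); exact: oeq_olt bs sb.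
- by case: nxs; apply/olt_succ; right; rewrite -e; exact: oeq_sym.
- case: nxs; apply/olt_succ; left; apply: olt_oeq (oeq_sym bs).
  exact/seg_olt.
Qed.

End CantorBendixson.

(** * Recursion, and combinatorics of [omega1] *)

(** Transfinite recursion with a choice at each stage. The first premise says that [P t] reads its
    function only below [t], so values elsewhere can be arbitrary. *)
Lemma wf_choice (T : Ord) (A : Type) (P : T -> (T -> A) -> A -> Prop) :
  (forall t f g a, (forall s, ord_lt s t -> f s = g s) -> P t f a -> P t g a) ->
  (forall t f, (forall s, ord_lt s t -> P s f (f s)) -> exists a, P t f a) ->
  inhabited A -> exists f, forall t, P t f (f t).
Proof.
move=> loc step [a0].
(* The values chosen so far, made total by the dummy value [a0]. *)
pose ext (t : T) (rec : forall s, ord_lt s t -> A) s :=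
  if pselect (ord_lt s t) is left st then rec s st else a0.
pose next (t : T) (rec : forall s, ord_lt s t -> A) :=
  if pselect (exists a, P t (ext t rec) a) is left h then projT1 (cid h) else a0.
pose f := Fix (@ord_lt_wf T) (fun=> A) next.
have fE t : f t = next t (fun s _ => f s).
  rewrite /f Fix_eq // => {}t r1 r2 e; congr next.
  by apply: functional_extensionality_dep => s; apply: funext => st; exact: e.
have extE t s : ord_lt s t -> f s = ext t (fun s _ => f s) s.
  by move=> st; rewrite /ext; case: pselect.
exists f; elim/(well_founded_ind (@ord_lt_wf T)) => t IH.
have [a Pa] := step t f IH.
rewrite fE /next; case: pselect => [h|[]]; last first.
  by exists a; apply: loc Pa; exact: extE.
apply: loc (projT2 (cid h)) => s st; exact/esym/extE.
Qed.

Lemma countable_setU (T : Type) (A B : set T) :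
  countable A -> countable B -> countable (A `|` B).
Proof.
move=> cA cB; apply: (@sub_countable _ _ _ (\bigcup_(b in [set: bool]) if b then A else B)).
  by apply: subset_card_le => x [Ax|Bx]; [exists true|exists false].
by apply: bigcup_countable => // -[].
Qed.

Section Omega1.
Variable K : Ord.
Hypothesis K_seg : forall k : K, countable [set i | ord_lt i k].
Hypothesis K_unc : ~ countable [set: K].

Lemma uncountable_inhabited : inhabited K.
Proof.
apply: contrapT => nK; apply: K_unc.
suff -> : [set: K] = set0 by exact: countable0.
by apply/seteqP; split=> // i _; case: nK.
Qed.

Lemma countable_iseg (k : K) : countable [set i | ord_le i k].
Proof.
have -> : [set i | ord_le i k] = [set i | ord_lt i k] `|` [set k].
  apply/seteqP; split=> i /=.
    by move=> ik; have [?|->|ki] := ord_lt_total i k; [left|right|move: ki; rewrite /ord_lt ik].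
  by case=> [/ord_ltW//|->]; exact: ord_le_refl.
by apply: countable_setU; [exact: K_seg|exact: countable1].
Qed.

(** Regularity: an unbounded countable [S] would make [K] a countable union of countable initial
    segments. *)
Lemma countable_bounded (S : set K) : countable S -> exists m, forall s, S s -> ord_lt s m.
Proof.
move=> cS; apply: contrapT => nb; apply: K_unc.
apply: (@sub_countable _ _ _ (\bigcup_(s in S) [set i | ord_le i s])).
  apply: subset_card_le => i _; apply: contrapT => ni; apply: nb; exists i => s Ss.
  by apply/negP => is_; apply: ni; exists s.
by apply: bigcup_countable => // s _; exact: countable_iseg.
Qed.

(** The form in which regularity is used below: countably many conditions, each holding from some
    index on, hold together at one index. *)
Lemma countable_uniform (I : Type) (Y : set I) (Q : I -> K -> Prop) : countable Y ->
  (forall y k l, ord_le k l -> Q y k -> Q y l) ->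
  (forall y, Y y -> exists k, Q y k) -> exists k, forall y, Y y -> Q y k.
Proof.
move=> cY Qm Yk.
have [i0] := uncountable_inhabited.
have [|f fP] := @choice I K (fun y k => Y y -> Q y k).
  by move=> y; have [/Yk[k]|ny] := pselect (Y y); [exists k|exists i0].
have [|m mP] := @countable_bounded (f @` Y); first exact: sub_countable (card_image_le _ _) cY.
exists m => y Yy; apply: Qm (fP y Yy); apply: ord_ltW; apply: mP; by exists y.
Qed.

(* The Ulam matrix: [g b] enumerates the predecessors of [b], so for some [n]
   uncountably many [x] occur as the [n]-th predecessor of uncountably many [b]. *)
Lemma unbounded_coloring :
  exists rho : K -> K, forall r k, exists2 i, ord_lt k i & rho i = r.
Proof.
have [|g gP] := @choice K (K -> nat) (fun b g =>
    forall x y, ord_lt x b -> ord_lt y b -> g x = g y -> x = y).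
  move=> b; have /countable_injP[f fi] := K_seg b; exists f => x y xb yb e.
  by apply: fi => //; rewrite inE.
have unc (S : nat -> set K) : ~ countable (\bigcup_n S n) -> exists n, ~ countable (S n).
  move=> ncS; apply: contrapT => nS; apply: ncS; apply: bigcup_countable => // n _.
  by apply: contrapT => nc; apply: nS; exists n.
have [|nn nnP] := @choice K nat (fun x n => ~ countable [set b | ord_lt x b /\ g b x = n]).
  move=> x; apply: unc => cx; apply: K_unc.
  apply: (@sub_countable _ _ _ ([set i | ord_le i x] `|`
      \bigcup_n [set b | ord_lt x b /\ g b x = n])).
    apply: subset_card_le => b _; rewrite /setU /=.
    case: (boolP (ord_le b x)) => [|xb]; first by left.
    by right; exists (g b x).
  by apply: countable_setU => //; exact: countable_iseg.
have [n ncS] : exists n, ~ countable [set x | nn x = n].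
  apply: (unc (fun n => [set x | nn x = n])) => cx; apply: K_unc; apply: sub_countable cx.
  by apply: subset_card_le => x _; exists (nn x).
(* [f] lists [K]-many distinct elements [x] with [nn x = n]; at each stage only countably many have
   been used. *)
have [|||f fP] := @wf_choice K K (fun k f s => nn s = n /\ forall l, ord_lt l k -> f l <> s).
- by move=> t f h s e [? H]; split=> // l lt; rewrite -e //; exact: H.
- move=> t f _; apply: contrapT => nf; apply: ncS.
  apply: (@sub_countable _ _ _ (f @` [set l | ord_lt l t])).
    apply: subset_card_le => s /= ns; apply: contrapT => nfs; apply: nf.
    exists s; split=> // l lt e.
    by apply: nfs; exists l.
  exact: sub_countable (card_image_le _ _) (K_seg t).
- exact: uncountable_inhabited.
have finj x y : f x = f y -> x = y.
  move=> e; have [xy|//|yx] := ord_lt_total x y.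
    by case: ((fP y).2 x xy).
  by case: ((fP x).2 y yx).
(* The colour of [b] is the [r] for which [f r] is its predecessor numbered [n], unique because [f]
   and [g b] are injective; it is arbitrary if there is none. *)
have [|rho rhoP] := @choice K K (fun b r =>
    forall r', ord_lt (f r') b /\ g b (f r') = n -> r' = r).
  move=> b; have [[r [rb gr]]|nr] := pselect (exists r, ord_lt (f r) b /\ g b (f r) = n).
    by exists r => r' [r'b gr']; apply: finj; apply: (gP b) => //; rewrite gr.
  by exists b => r' h; case: nr; exists r'.
exists rho => r k; apply: contrapT => nik; apply: (nnP (f r)); rewrite (fP r).1.
apply: (@sub_countable _ _ _ [set i | ord_le i k]); last exact: countable_iseg.
apply: subset_card_le => b /= h; apply: contrapT => kb; apply: nik; exists b.
  exact/negP.
by apply/esym/rhoP.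
Qed.

End Omega1.

(** * The pieces *)

Section Construction.
Variables (T K : Ord) (rho : K -> K) (h : T -> T -> K) (k0 : K).
Hypothesis K_seg : forall k : K, countable [set i | ord_lt i k].
Hypothesis K_unc : ~ countable [set: K].
Hypothesis rho_unbounded : forall r k, exists2 i, ord_lt k i & rho i = r.
Hypothesis h_countable : forall t i, countable [set b | ord_lt b t /\ ord_lt (h t b) i].
Hypothesis k0_min : forall k, ord_le k0 k.

(** Tails of stages replace cocountable sets of stages, as countable sets of stages are bounded.
    Only [W x.1] is read, so the pieces can be chosen by recursion on the level. *)
Definition nb (W : T -> K -> set (T * K)) (x : T * K) (k : K) : set (T * K) :=
  [set y | y = x \/ exists i, [/\ ord_le k i, rho i = x.2 & W x.1 i y]].

Definition nb_union (W : T -> K -> set (T * K)) (t : T) (A : set (T * K)) : Prop :=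
  exists Y : set ((T * K) * K), [/\ countable Y, forall y, Y y -> ord_lt y.1.1 t
    & A = \bigcup_(y in Y) nb W y.1 y.2].

(* [h t] lists the levels below [t]: those listed before stage [i] are the [b]
   with [h t b < i]. In the use below, [V j] is the piece chosen at stage [j < i]. *)
Definition good_piece (W : T -> K -> set (T * K)) (t : T) (i : K)
    (V : K -> set (T * K)) (A : set (T * K)) : Prop :=
  [/\ nb_union W t A,
      forall x, A x -> ord_lt x.1 t,
      forall j x, ord_lt j i -> A x -> ~ V j x &
      forall b, ord_lt b t -> ord_lt (h t b) i ->
      [/\ exists r, A (b, r),
          forall r, ord_lt r i -> forall x, A x -> ~ nb W (b, r) k0 x
        & forall r, ord_lt (rho r) i -> ~ A (b, r)]].

Definition good (t : T) (W : T -> K -> set (T * K)) (V : K -> set (T * K)) : Prop :=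
  forall i, good_piece W t i V (V i).

Lemma nb_refl W x k : nb W x k x. Proof. by left. Qed.

Lemma nb_sub W x k l : ord_le k l -> nb W x l `<=` nb W x k.
Proof.
move=> kl y [->|[i [li ri Wi]]]; first by left.
by right; exists i; split=> //; exact: ord_le_trans li.
Qed.

Lemma nb_sub0 W x k : nb W x k `<=` nb W x k0.
Proof. exact/nb_sub/k0_min. Qed.

Lemma exists_above_both (k l : K) : exists m, ord_lt k m /\ ord_lt l m.
Proof.
have [|m mP] := @countable_bounded K K_seg K_unc ([set k] `|` [set l]).
  by apply: countable_setU; exact: countable1.
by exists m; split; apply: mP; [left|right].
Qed.

(** * Countability, separation and closedness of basic neighbourhoods *)

Section Below.
(** [D] will be the levels below [t] while the pieces at [t] are being chosen, and all levels once
    [W] is complete. *)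
Variables (W : T -> K -> set (T * K)) (D : T -> Prop).
Hypothesis D_down : forall s t, ord_lt s t -> D t -> D s.
Hypothesis D_good : forall t, D t -> good t W (W t).

Lemma nb_level x k y : D x.1 -> nb W x k y -> y = x \/ ord_lt y.1 x.1.
Proof.
move=> Dx [->|[i [_ _ Wi]]]; [by left|right].
by have [_ lt _ _] := D_good Dx i; exact: lt.
Qed.

Lemma W_nb_union t i : D t -> nb_union W t (W t i).
Proof. by move=> Dt; have [] := D_good Dt i. Qed.

(** Induction on the level of [x]. Pieces past both [h t b] and [xi] avoid the column; the countably
    many earlier ones are countable unions of lower neighbourhoods. *)
Lemma nb_column x b xi : D x.1 -> countable [set r | rho r = xi /\ nb W x k0 (b, r)].
Proof.
move: x; suff H t : D t -> forall r, countable [set q | rho q = xi /\ nb W (t, r) k0 (b, q)].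
  by case=> t r Dt; exact: H.
elim/(well_founded_ind (@ord_lt_wf T)): t => t IH Dt r.
have [bt|] := boolP (ord_lt b t); last first.
  move=> nbt; apply: (@sub_countable _ _ _ [set r]); last exact: countable1.
  apply: subset_card_le => q /= [_ /(@nb_level (t, r) _ _ Dt)] [[]//|/= bt].
  by rewrite bt in nbt.
have [m [hm xm]] := exists_above_both (h t b) xi.
have Wcol i : countable [set q | rho q = xi /\ W t i (b, q)].
  have [Y [cY Yt ->]] := W_nb_union i Dt.
  apply: (@sub_countable _ _ _ (\bigcup_(y in Y) [set q | rho q = xi /\ nb W y.1 k0 (b, q)])).
    by apply: subset_card_le => q /= [rq [y Yy /nb_sub0 yq]]; exists y.
  apply: bigcup_countable => // -[[s p] k] /Yt /= st.
  by apply: IH => //; exact: D_down Dt.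
apply: (@sub_countable _ _ _ ([set r] `|`
    \bigcup_(i in [set i | ord_lt i m]) [set q | rho q = xi /\ W t i (b, q)])); last first.
  apply: countable_setU; first exact: countable1.
  by apply: bigcup_countable => //; exact: K_seg.
apply: subset_card_le => q /= [rq [[_ ->]|[i [_ _ /= Wi]]]]; first by left.
right; exists i => //=; apply/negP => mi.
have [_ _ _ /(_ b bt)] := D_good Dt i.
move=> /(_ (ord_lt_le_trans hm mi)) [_ _ /(_ q)]; apply=> //.
by rewrite rq; exact: ord_lt_le_trans mi.
Qed.

Lemma W_eventually_disjoint t y : D t -> ord_lt y.1 t ->
  exists m, forall i, ord_le m i -> forall x, W t i x -> ~ nb W y k0 x.
Proof.
case: y => s r Dt /= st; have [m [hm rm]] := exists_above_both (h t s) r.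
exists m => i mi x Wx.
have [_ _ _ /(_ s st)] := D_good Dt i.
by case/(_ (ord_lt_le_trans hm mi)) => _ /(_ r (ord_lt_le_trans rm mi) x Wx).
Qed.

Lemma nb_disjoint_lower x y : D x.1 -> ord_lt y.1 x.1 ->
  exists k, forall z, nb W x k z -> ~ nb W y k0 z.
Proof.
move=> Dx yx; have [m mP] := W_eventually_disjoint Dx yx.
exists m => z [->|[i [mi _ Wi]]]; last exact: mP mi _ Wi.
move=> /(nb_level (D_down yx Dx))[xy|xy]; first by rewrite xy ord_lt_irr in yx.
by have := ord_lt_trans xy yx; rewrite ord_lt_irr.
Qed.

(** The pieces at one level are pairwise disjoint and lie strictly below it, and each belongs to a
    single colour. *)
Lemma nb_disjoint_level x y : D x.1 -> x.1 = y.1 -> x <> y ->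
  forall z, nb W x k0 z -> ~ nb W y k0 z.
Proof.
case: x => t p; case: y => s q /= Dt ts; subst s => xy z.
have nlt i r : ~ W t i (t, r).
  by have [_ + _ _] := D_good Dt i => /[apply] /=; rewrite ord_lt_irr.
case=> [->|[i [_ /= ri Wi]]] [|[j [_ /= rj Wj]]] //.
- by move: Wj => /nlt.
- by move=> e; move: Wi; rewrite e => /nlt.
have [ij|ij|ij] := ord_lt_total i j.
- by have [_ _ /(_ i z ij Wj)] := D_good Dt j.
- by apply: xy; rewrite -ri -rj ij.
- by have [_ _ /(_ j z ij Wi)] := D_good Dt i.
Qed.

Lemma nb_separated x y : D x.1 -> D y.1 -> x <> y ->
  exists k l, forall z, nb W x k z -> ~ nb W y l z.
Proof.
move=> Dx Dy xy; have [lt|e|gt] := ord_lt_total x.1 y.1.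
- by have [k kP] := nb_disjoint_lower Dy lt; exists k0, k => z zx zy; exact: kP zy zx.
- by exists k0, k0; exact: nb_disjoint_level.
- by have [k kP] := nb_disjoint_lower Dx gt; exists k, k0.
Qed.

Lemma nb_avoid_countable x (C : set (T * K)) : D x.1 -> countable C -> ~ C x ->
  (forall y, C y -> D y.1) -> exists k, forall y, C y -> ~ nb W x k y.
Proof.
move=> Dx cC nx CD.
apply: (@countable_uniform K K_seg K_unc (T * K)%type C
  (fun y k => ~ nb W x k y)) => // [y k l kl|y Cy].
  by move=> nk /(nb_sub kl).
have [|k [l kl]] := @nb_separated x y Dx (CD y Cy); first by move=> e; rewrite e in nx.
by exists k => /kl; apply; exact: nb_refl.
Qed.

(** Induction on the level [s] of [y]; the case of substance is [x] below [s]. Late pieces at [s]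
    miss a whole neighbourhood of [x]; the countably many earlier ones are countable unions of lower
    neighbourhoods, closed by induction, so one index for [x] avoids them all. The point [y] itself
    is avoided separately. *)
Lemma nb_closed y l x : D y.1 -> D x.1 -> ~ nb W y l x ->
  exists k, forall z, nb W x k z -> ~ nb W y l z.
Proof.
case: y => s q /=; elim/(well_founded_ind (@ord_lt_wf T)): s q l => s IH q l Ds Dx nyx.
have [lt|e|gt] := ord_lt_total x.1 s; last 2 first.
- exists k0 => z xz /nb_sub0; apply: (nb_disjoint_level Dx) => // xy.
  by apply: nyx; rewrite xy; exact: nb_refl.
- have [k kP] := @nb_disjoint_lower x (s, q) Dx gt.
  by exists k => z /kP nz /nb_sub0.
have [m mP] := W_eventually_disjoint Ds lt.
pose I := [set i | [/\ ord_lt i m, ord_le l i & rho i = q]].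
have cI : countable I by apply: sub_countable (K_seg m); apply: subset_card_le => i [].
have [||k kP] := @countable_uniform K K_seg K_unc K I
    (fun i k => forall z, nb W x k z -> ~ W s i z) cI.
- by move=> i k k' kk' H z /(nb_sub kk'); exact: H.
- move=> i [im li ri].
  have nWx : ~ W s i x by move=> Wx; apply: nyx; right; exists i.
  have [Y [cY Ys WE]] := W_nb_union i Ds.
  have [||k kP] := @countable_uniform K K_seg K_unc _ Y
      (fun y k => forall z, nb W x k z -> ~ nb W y.1 y.2 z) cY.
  - by move=> y k k' kk' H z /(nb_sub kk'); exact: H.
  - move=> [[s' q'] l'] Yy; have /= lts := Ys _ Yy; apply: IH => //.
      exact: D_down Ds.
    by move=> yx; apply: nWx; rewrite WE; exists (s', q', l').
  by exists k => z xz; rewrite WE => -[y Yy]; exact: kP xz.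
have [k1 kP1] : exists k1, forall z, nb W x k1 z -> z <> (s, q).
  have [||k1 H] := @nb_avoid_countable x [set (s, q)] Dx (countable1 _).
  - by move=> /= e; apply: nyx; rewrite e; exact: nb_refl.
  - by move=> y /= ->.
  by exists k1 => z xz zs; exact: (H z zs).
have [k2 [/ord_ltW kk2 /ord_ltW k1k2]] := exists_above_both k k1.
exists k2 => z xz [|[i [li /= ri Wi]]]; first exact: kP1 (nb_sub k1k2 xz).
have [mi|im] := boolP (ord_le m i).
  by apply: (mP i mi z Wi); exact: nb_sub0 xz.
by apply: kP Wi; [split|exact: nb_sub xz].
Qed.

End Below.

(** For each listed level [b], choose a point of column [i] outside the countably many
    neighbourhoods to be avoided: they cover only countably much of the column. Since they are
    closed, a small enough neighbourhood of the point avoids them too, and the piece is the union of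
    these over [b]. *)
Lemma good_piece_exists t i W V :
  (forall s, ord_lt s t -> good s W (W s)) ->
  (forall j, ord_lt j i -> good_piece W t j V (V j)) ->
  exists A, good_piece W t i V A.
Proof.
move=> Wgood Vgood; pose D s := ord_lt s t.
have D_down r s : ord_lt r s -> D s -> D r by exact: ord_lt_trans.
pose B := [set b | ord_lt b t /\ ord_lt (h t b) i].
have cB : countable B by exact: h_countable.
have [|Y YP] := @choice K (set ((T * K) * K)) (fun j Y => ord_lt j i ->
    [/\ countable Y, forall y, Y y -> ord_lt y.1.1 t & V j = \bigcup_(y in Y) nb W y.1 y.2]).
  move=> j; have [ji|nji] := pselect (ord_lt j i); last by exists set0.
  by have [[Y YP] _ _ _] := Vgood j ji; exists Y.
(* The neighbourhoods to be avoided: the constituents of the earlier pieces, and the full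
   neighbourhoods of the points [(b, r)] with [b] listed and [r < i]. *)
pose Z := (\bigcup_(j in [set j | ord_lt j i]) Y j) `|`
          (\bigcup_(b in B) ((fun r => ((b, r), k0)) @` [set r | ord_lt r i])).
have cZ : countable Z.
  apply: countable_setU; apply: bigcup_countable => //.
    by move=> j /= /YP[].
  by move=> b _; exact: sub_countable (card_image_le _ _) (K_seg i).
have ZD y : Z y -> D y.1.1.
  by move=> [[j /= /YP[_ YD _] /YD//]|[b [bt _] [r _ <-]]].
have [|r rP] := @choice T K (fun b r => B b -> exists k,
    [/\ rho r = i, forall y z, Z y -> nb W (b, r) k z -> ~ nb W y.1 y.2 z &
        forall c q, B c -> ord_lt (rho q) i -> ~ nb W (b, r) k (c, q)]).
  move=> b; have [[bt hb]|nB] := pselect (B b); last by exists k0.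
  (* [m] bounds the points of column [i] at level [b] covered by [Z], so any point of that column
     beyond [m] will do. *)
  have [|m mP] := @countable_bounded K K_seg K_unc
      (\bigcup_(y in Z) [set r | rho r = i /\ nb W y.1 k0 (b, r)]).
    by apply: bigcup_countable => // y /ZD Dy; exact: (@nb_column W D).
  have [r /ord_ltW mr ri] := rho_unbounded i m.
  have nZr y : Z y -> ~ nb W y.1 y.2 (b, r).
    move=> Zy /nb_sub0 yr.
    suff : ord_lt r m by rewrite /ord_lt mr.
    by apply: mP; exists y.
  exists r => _.
  have [||k1 k1P] := @countable_uniform K K_seg K_unc _ Z
      (fun y k => forall z, nb W (b, r) k z -> ~ nb W y.1 y.2 z) cZ.
  - by move=> y k k' kk' H z /(nb_sub kk'); exact: H.
  - by move=> y Zy; apply: (@nb_closed W D) => //; [exact: ZD|exact: nZr].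
  (* The points near [(b, r)] in forbidden columns, of index below [i] at listed levels. They are
     countably many, and [(b, r)] is not among them because its column has index [i]. *)
  pose C := \bigcup_(c in B) \bigcup_(xi in [set xi | ord_lt xi i])
    ((fun q => (c, q)) @` [set q | rho q = xi /\ nb W (b, r) k0 (c, q)]).
  have [|||k2 k2P] := @nb_avoid_countable W D D_down Wgood (b, r) C bt.
  - apply: bigcup_countable => // c _; apply: bigcup_countable => [|xi _]; first exact: K_seg.
    by apply: sub_countable (card_image_le _ _) _; exact: (@nb_column W D).
  - move=> [c _ [xi /= xii [q [rq _] [_ qr]]]].
    by move: xii; rewrite -rq qr ri ord_lt_irr.
  - by move=> y [c [ct _] [xi _ [q _ <-]]].
  have [k [/ord_ltW k1k /ord_ltW k2k]] := exists_above_both k1 k2.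
  exists k; split=> // [y z Zy /(nb_sub k1k)|c q Bc rq kq]; first exact: k1P.
  apply: (k2P (c, q)); last exact: nb_sub kq.
  by exists c => //; exists (rho q) => //; exists q => //; split=> //; exact: nb_sub0 kq.
have [|k kP] := @choice T K (fun b k => B b ->
    [/\ rho (r b) = i, forall y z, Z y -> nb W (b, r b) k z -> ~ nb W y.1 y.2 z &
        forall c q, B c -> ord_lt (rho q) i -> ~ nb W (b, r b) k (c, q)]).
  by move=> b; have [/rP[k kP]|nB] := pselect (B b); [exists k|exists k0].
exists (\bigcup_(b in B) nb W (b, r b) (k b)); split.
- exists ((fun b => ((b, r b), k b)) @` B); split.
  + exact: sub_countable (card_image_le _ _) cB.
  + by move=> _ [b [bt _] <-].
  + by rewrite bigcup_image.
- move=> x [b [bt _]] /(@nb_level W D Wgood)[//|-> //|/= xb].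
  exact: ord_lt_trans bt.
- move=> j x ji [b /kP[_ kb _] bx]; have [_ _ ->] := YP j ji.
  by case=> y Yy; apply: kb bx; left; exists j.
move=> b bt hb; have Bb : B b by []; split.
- by exists (r b), b => //; exact: nb_refl.
- move=> q qi x [c /kP[_ kc _] cx]; apply: (kc ((b, q), k0)) cx.
  by right; exists b => //; exists q.
- by move=> q rq [c /kP[_ _ kc]]; exact: kc.
Qed.

(** A recursion on stages nested in a recursion on levels: [good t] reads [W] only below [t], and
    [good_piece] reads [V] only below [i]. *)
Lemma good_exists : exists W : T -> K -> set (T * K), forall t, good t W (W t).
Proof.
apply: (@wf_choice T (K -> set (T * K)) good); last by exists=> _; exact: set0.
- move=> t W W' V e gV i; have [[Y [cY Yt VE]] Vt Vd Vb] := gV i.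
  have nbE y l : ord_lt y.1 t -> nb W' y l = nb W y l by move=> yt; rewrite /nb e.
  split=> //.
    exists Y; split=> //; rewrite VE; apply: eq_bigcupr => y Yy.
    by rewrite nbE //; exact: Yt.
  move=> b bt hb; have [? Vn ?] := Vb b bt hb; split=> // r ri x.
  by rewrite nbE //; exact: Vn.
- move=> t W Wgood.
  apply: (@wf_choice K (set (T * K)) (good_piece W t)); last by exists; exact: set0.
    move=> i V V' A e [? ? Vd ?]; split=> // j x ji.
    by rewrite -e //; exact: Vd.
  by move=> i V; exact: good_piece_exists.
Qed.

End Construction.

(** * The space *)

(** A weak base: a set will be open when it contains some [nb_set x k] for each of its points
    [x]. *)
Record nbSystem := NbSystem {
  nb_point : Type;
  nb_index : Type;
  nb_set : nb_point -> nb_index -> set nb_point;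
  nb_inhabited : inhabited nb_index;
  nb_directed : forall x k l, exists m, nb_set x m `<=` nb_set x k `&` nb_set x l }.

Definition nb_space (S : nbSystem) : Type := nb_point S.

HB.instance Definition _ (S : nbSystem) := gen_eqMixin (nb_space S).
HB.instance Definition _ (S : nbSystem) := gen_choiceMixin (nb_space S).

Section NbTopology.
Variable S : nbSystem.

Definition nb_op : set_system (nb_space S) :=
  [set A | forall x, A x -> exists k, nb_set x k `<=` A].

Lemma nb_opT : nb_op setT.
Proof. by move=> x _; have [k] := nb_inhabited S; exists k. Qed.

Lemma nb_opI : setI_closed nb_op.
Proof.
move=> A B oA oB x [/oA[k kA] /oB[l lB]]; have [m mkl] := nb_directed x k l.
by exists m => y /mkl[/kA Ay /lB By].
Qed.

Lemma nb_op_bigU (I : Type) (f : I -> set (nb_space S)) :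
  (forall i, nb_op (f i)) -> nb_op (\bigcup_i f i).
Proof.
move=> of_ x [i _ /of_[k kf]]; exists k => y /kf fy.
by exists i.
Qed.

HB.instance Definition _ := isOpenTopological.Build (nb_space S) nb_opT nb_opI nb_op_bigU.

Lemma nb_openE (A : set (nb_space S)) : open A = nb_op A.
Proof. by []. Qed.

End NbTopology.

Lemma lindelof_bigcup (X : topologicalType) (I : Type) (J : set I) (F : I -> set X) :
  countable J -> (forall i, J i -> lindelof (F i)) -> lindelof (\bigcup_(i in J) F i).
Proof.
move=> cJ lF U oU cov.
have [|V VP] := @choice I (set (set X)) (fun i V => J i ->
    [/\ V `<=` U, countable V & F i `<=` \bigcup_(u in V) u]).
  move=> i; have [Ji|nJ] := pselect (J i); last by exists set0.
  have [|V VP] := lF i Ji U oU; last by exists V.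
  by move=> x Fx; apply: cov; exists i.
exists (\bigcup_(i in J) V i); split.
- by move=> u [i /VP[VU _ _] /VU].
- by apply: bigcup_countable => // i /VP[].
- move=> x [i Ji Fx]; have [_ _ /(_ x Fx)[u Vu ux]] := VP i Ji.
  by exists u => //; exists i.
Qed.

Section ThinTallSpace.
Variables (T K : Ord) (rho : K -> K) (h : T -> T -> K) (k0 : K).
Hypothesis K_seg : forall k : K, countable [set i | ord_lt i k].
Hypothesis K_unc : ~ countable [set: K].
Hypothesis rho_unbounded : forall r k, exists2 i, ord_lt k i & rho i = r.
Hypothesis k0_min : forall k, ord_le k0 k.
Variable W : T -> K -> set (T * K).
Hypothesis W_good : forall t, good rho h k0 t W (W t).

Let N := nb rho W.

Lemma N_directed (x : T * K) (k l : K) : exists m, N x m `<=` N x k `&` N x l.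
Proof.
have [m [/ord_ltW km /ord_ltW lm]] := exists_above_both K_seg K_unc k l.
by exists m => y xy; split; exact: nb_sub xy.
Qed.

Definition thin_tall : topologicalType :=
  nb_space (@NbSystem (T * K)%type K N (inhabits k0) N_directed).

Implicit Types x y : thin_tall.

Let lev x : T := x.1.

Let lvl x k y : N x k y -> y = x \/ ord_lt (lev y) (lev x).
Proof. exact: (@nb_level _ _ _ _ _ W (fun=> True)). Qed.

(** By induction on the level, since a piece is a union of neighbourhoods of lower level. *)
Lemma N_open (x : thin_tall) k : open (N x k : set thin_tall).
Proof.
rewrite nb_openE; case: x => t r; elim/(well_founded_ind (@ord_lt_wf T)): t r k => t IH r k.
move=> z [->|[i [ki ri Wi]]]; first by exists k.
have [Y [_ Yt WE]] := @W_nb_union _ _ _ _ _ W (fun=> True) (fun t _ => W_good t) t i I.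
move: Wi; rewrite /= WE => -[y Yy yz].
have : nb_op (N y.1 y.2 : set thin_tall) by case: y Yy {yz} => -[s q] l /Yt st; exact: IH.
move=> /(_ z yz)[l zl]; exists l => w /zl yw.
by right; exists i; split=> //=; rewrite WE; exists y.
Qed.

Lemma nbhs_N x (A : set thin_tall) : nbhs x A <-> exists k, N x k `<=` A.
Proof.
split=> [|[k kA]]; last first.
  by rewrite nbhsE; exists (N x k) => //; split; [exact: N_open|exact: nb_refl].
rewrite nbhsE => -[B [oB Bx] BA]; have [k kB] := oB x Bx.
by exists k; apply: subset_trans BA.
Qed.

(** One member of the cover contains the centre and all its pieces from some stage [l] on. Countably
    many pieces remain, each Lindelöf as a countable union of neighbourhoods that are Lindelöf by
    induction. *)
Lemma N_lindelof x k : lindelof (N x k : set thin_tall).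
Proof.
case: x => t r; elim/(well_founded_ind (@ord_lt_wf T)): t r k => t IH r k U oU cov.
have [u Uu ux] := cov (t, r) (nb_refl _ _ _ _).
have [l lu] := oU u Uu (t, r) ux.
pose J := [set i | [/\ ord_lt i l, ord_le k i & rho i = r]].
have cJ : countable J by apply: sub_countable (K_seg l); apply: subset_card_le => i [].
have lW i : lindelof (W t i : set thin_tall).
  have [Y [cY Yt ->]] := @W_nb_union _ _ _ _ _ W (fun=> True) (fun t _ => W_good t) t i I.
  by apply: lindelof_bigcup => // -[[s q] m] /Yt /= st; exact: IH.
have [V [VU cV WV]] : exists V, [/\ V `<=` U, countable V &
    (\bigcup_(i in J) W t i : set thin_tall) `<=` \bigcup_(v in V) v].
  apply: lindelof_bigcup => // z [i [_ ki ri] Wz]; apply: cov.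
  by right; exists i.
exists (V `|` [set u]); split.
- by move=> v [/VU//|->].
- by apply: countable_setU => //; exact: countable1.
move=> z [->|[i [ki ri Wi]]]; first by exists u => //; right.
have [il|li] := boolP (ord_lt i l).
  by have [|v Vv vz] := WV z; [exists i|exists v => //; left].
exists u; first by right.
by apply: lu; right; exists i; split=> //; rewrite ord_le_lt.
Qed.

Lemma thin_tall_P_space : P_space thin_tall.
Proof.
move=> U oU; rewrite nb_openE => x Ux.
have [|||k kP] := @countable_uniform K K_seg K_unc nat setT (fun n k => N x k `<=` U n).
- exact: countableP.
- by move=> n k l kl; apply: subset_trans; exact: nb_sub.
- by move=> n _; apply: (oU n x); exact: Ux.
by exists k => y ky n _; exact: kP ky.
Qed.

Lemma thin_tall_hausdorff : hausdorff_space thin_tall.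
Proof.
move=> x y cxy; apply: contrapT => xy.
have [k [l kl]] := @nb_separated T K rho h k0 K_seg K_unc W (fun=> True)
  (fun _ _ _ _ => I) (fun t _ => W_good t) x y I I xy.
have Nx : nbhs x (N x k) by apply/nbhs_N; exists k.
have Ny : nbhs y (N y l) by apply/nbhs_N; exists l.
by have [z [/kl]] := cxy _ _ Nx Ny.
Qed.

Lemma thin_tall_CB a : @CB thin_tall a = [set x | ~ olt (seg (lev x)) a].
Proof.
apply: CB_lev => [x|x s U sx /nbhs_N[k kU]].
  exists (N x k0); first by apply/nbhs_N; exists k0.
  by move=> y /lvl[->|].
(* Past stage [h (lev x) s] every piece has a point of level [s]; a late piece of the colour of [x]
   lies in [N x k]. *)
have [m [km hm]] := exists_above_both K_seg K_unc k (h (lev x) s).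
have [i mi ri] := rho_unbounded x.2 m.
have [_ _ _ /(_ s sx (ord_lt_trans hm mi))[[r Wr] _ _]] := W_good (lev x) i.
exists (s, r) => //; apply: kU; right; exists i; split=> //.
exact: ord_ltW (ord_lt_trans km mi).
Qed.

Lemma thin_tall_LLSP : LLSP thin_tall.
Proof.
split; last exact: thin_tall_P_space.
- by move=> x; exists (N x k0); [apply/nbhs_N; exists k0|exact: N_lindelof].
- exists T; rewrite thin_tall_CB; apply/seteqP; split=> // x /=; apply; exact: olt_seg.
- exact: thin_tall_hausdorff.
Qed.

Lemma thin_tall_ht : is_ht thin_tall T.
Proof.
split; first by rewrite thin_tall_CB; apply/seteqP; split=> // x /=; apply; exact: olt_seg.
move=> b /oltE[t bt]; rewrite thin_tall_CB => /seteqP[/(_ (t, k0)) + _]; apply => /= tb.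
by apply: (@olt_irr b); exact: oeq_olt bt tb.
Qed.

(** By [seg_inj] the points of one level share their first coordinate, so a level is covered by one
    copy of [K]. Conversely, the level of [t0] contains every [(t0, r)]. *)
Lemma thin_tall_wd : inhabited T -> is_wd thin_tall K.
Proof.
case=> t0; split=> [H a _ _|c /(_ T (seg t0) thin_tall_ht (olt_seg t0))].
  have levelE x : CB_level a x -> oeq (seg (lev x)) a.
    rewrite /CB_level !thin_tall_CB => -[/= nxa /contrapT/olt_succ[]//].
  have [[x /levelE xa]|nx] := pselect (exists x, @CB_level thin_tall a x); last first.
    have -> : @CB_level thin_tall a = set0; last exact: card_ge0.
    by apply/seteqP; split=> // x ax; apply: nx; exists x.
  apply: card_le_trans (card_image_le (fun r => (lev x, r) : thin_tall) _).
  apply: subset_card_le => y /levelE ya; exists y.2 => //.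
  by rewrite [RHS]surjective_pairing; congr pair; apply: seg_inj; exact: oeq_trans (oeq_sym ya).
apply: card_le_trans; apply: card_le_trans (card_image_le (snd : thin_tall -> K) _).
apply: subset_card_le => r _; exists (t0, r) => //.
rewrite /CB_level !thin_tall_CB; split=> /=; first exact: olt_irr.
by apply; apply/olt_succ; right; exact: oeq_refl.
Qed.

End ThinTallSpace.

(** * The case of [omega1] and [omega2] *)

Lemma omega1_seg (k : omega1) : countable [set i | ord_lt i k].
Proof.
have := (hartogsP nat).2 _ (olt_seg k) => kN.
apply: (@sub_countable _ _ _ ((@sval _ _ : seg k -> omega1) @` setT)).
  by apply: subset_card_le => i ik; exists (exist _ i ik).
exact: sub_countable (card_image_le _ _) kN.
Qed.

Lemma omega1_uncountable : ~ countable [set: omega1].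
Proof. exact: (hartogsP nat).1. Qed.

(** Segments of [omega2] inject into [omega1]; taking [h t] injective below [t], the preimage of a
    countable initial segment is countable. *)
Lemma omega2_seg : exists h : omega2 -> omega2 -> omega1,
  forall t i, countable [set b | ord_lt b t /\ ord_lt (h t b) i].
Proof.
have [k0] := uncountable_inhabited omega1_uncountable.
have [|h hP] := @choice omega2 (omega2 -> omega1) (fun t g =>
    forall b c, ord_lt b t -> ord_lt c t -> g b = g c -> b = c).
  move=> t; have /card_leP[f] := (hartogsP omega1).2 _ (olt_seg t).
  pose g (z : seg t) := val (f (SigSub (in_setT z))).
  have g_inj : injective g.
    by move=> y z /val_inj e; have [] := 'inj_f (in_setT _) (in_setT _) e.
  exists (fun b => if pselect (ord_lt b t) is left bt then g (exist _ b bt) else k0).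
  by move=> b c bt ct; case: pselect => // bt'; case: pselect => // ct' /g_inj[].
exists h => t i; apply: (@sub_countable _ _ _ [set j | ord_lt j i]); last exact: omega1_seg.
have h_inj : {in [set b | ord_lt b t /\ ord_lt (h t b) i] &, injective (h t)}.
  by move=> b c; rewrite !inE => -[bt _] [ct _]; exact: hP.
rewrite -(card_le_eql (inj_card_eq h_inj)); apply: subset_card_le.
by move=> _ [b [_ hb] <-].
Qed.

Theorem theorem2p1 : exists X : topologicalType, kappa_alpha_LLSP X omega1 omega2.
Proof.
have [k] := uncountable_inhabited omega1_uncountable.
(* The least index gives the largest basic neighbourhood of each point. *)
have [k0 _ k0P] := @ord_min omega1 (fun=> True) k I.
have [rho rhoP] := unbounded_coloring omega1_seg omega1_uncountable.
have [h hP] := omega2_seg.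
have [|W Wgood] := @good_exists omega2 omega1 rho h k0 omega1_seg omega1_uncountable rhoP hP.
  by move=> l; exact: k0P.
exists (thin_tall rho k0 omega1_seg omega1_uncountable W); split.
- exact: (@thin_tall_LLSP _ _ _ h).
- exact: (@thin_tall_ht _ _ _ h).
apply: (@thin_tall_wd _ _ _ h) => //.
(* An empty [omega2] would inject into [omega1]. *)
apply: contrapT => nT; apply: (hartogsP omega1).1.
suff -> : [set: hartogs omega1] = set0 by exact: card_ge0.
by apply/seteqP; split=> // t _; case: nT.
Qed.
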